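(* Given $\eta,\alpha\in(0,1)$, there exist two probability distributions $\mathcal{D}_1$ and $\mathcal{D}_2$ over $\mathbb{R}$ with means $\mu_1$ and $\mu_2$, respectively, satisfying: (1) $d_{TV}(\mathcal{D}_1,\mathcal{D}_2)\le\frac{\eta}{4}$; (2) $|\mu_1-\mu_2|\ge\frac14\cdot\eta^{\alpha/(1+\alpha)}$; (3) $\mathbb{E}_{X\sim\mathcal{D}_1}\left[|X-\mu_1|^{1+\alpha}\right]\le1$ and $\mathbb{E}_{X\sim\mathcal{D}_2}\left[|X-\mu_2|^{1+\alpha}\right]\le 1$.
   Context: $d_{TV}$ denotes the total variation distance between probability distributions, $d_{TV}(P,Q)=\sup_A|P(A)-Q(A)|$. *)

(* Defs.v *)
From HB Require Import structures.
From mathcomp Require Import all_boot all_order all_algebra.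
From mathcomp Require Import all_classical all_reals all_analysis.

Set Implicit Arguments.
Unset Strict Implicit.
Unset Printing Implicit Defensive.

Import Order.TTheory GRing.Theory Num.Theory.
Import numFieldNormedType.Exports.

Local Open Scope classical_set_scope.
Local Open Scope ring_scope.

Definition dTV (d : measure_display) (T : measurableType d) (R : realType)
    (P Q : probability T R) : \bar R :=
  ereal_sup [set `|P A - Q A|%E | A in measurable].

(* Integrability is required explicitly because the library's integral is total:
   without it, ['E_P[id] = m%:E] would not by itself say that the mean exists. *)
Definition has_mean (R : realType) (P : probability (measurableTypeR R) R)
    (m : R) : Prop :=
  P.-integrable setT (EFin \o id) /\ 'E_P[id]%E = m%:E.

Definition central_abs_moment (R : realType)
    (P : probability (measurableTypeR R) R) (m p : R) : \bar R :=
  'E_P[fun x : R => (`|x - m| `^ p)%R]%E.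

(* Main.v *)
Require Import Defs.
From HB Require Import structures.
From mathcomp Require Import all_boot all_order all_algebra.
From mathcomp Require Import all_classical all_reals all_analysis.
From mathcomp Require Import measurable_realfun ring lra.
Import Order.TTheory GRing.Theory Num.Theory.
Import numFieldNormedType.Exports.
Local Open Scope classical_set_scope.
Local Open Scope ring_scope.

(** Take the point mass at 0 and move a mass p = eta / 4 of it to
    c = eta^(-1/(1+alpha)): the total variation distance is at most p, the mean
    moves by p c = eta^(alpha/(1+alpha)) / 4, and since p c^(1+alpha) = 1/4 the
    (1+alpha)-th central moment stays bounded by 1. *)

Definition two_point_fun {R : realType} (a b : R) (t : bool) :
  measurableTypeR R := if t then b else a.

Lemma measurable_two_point_fun {R : realType} (a b : R) :
  measurable_fun setT (two_point_fun a b).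
Proof. by []. Qed.

HB.instance Definition _ (R : realType) (a b : R) :=
  isMeasurableFun.Build _ _ _ _ (two_point_fun a b)
    (measurable_two_point_fun a b).

(** Pushing a Bernoulli law forward from [bool] keeps measurability trivial, since [bool] is
    discrete, and change of variables turns every expectation into a two-term sum. *)
Definition two_point {R : realType} (p a b : R) :
    probability (measurableTypeR R) R :=
  distribution (bernoulli_prob p) (two_point_fun a b).

Lemma integrable_bernoulli_prob {R : realType} {p : R} (f : bool -> R) :
  0 <= p <= 1 -> (bernoulli_prob p).-integrable setT (EFin \o f).
Proof.
move=> p01; apply/integrableP; split; first by [].
by rewrite integral_bernoulli_prob//= -!EFinM -EFinD ltry.
Qed.

(** The formula for nonnegative integrands applies to the positive and negative parts of [f]; they
    recombine through max(x, 0) - max(-x, 0) = x. *)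
Lemma integral_bernoulli_prob_EFin {R : realType} (p : R) (f : bool -> R) :
  0 <= p <= 1 ->
  (\int[bernoulli_prob p]_t (f t)%:E = (p * f true + (1 - p) * f false)%:E)%E.
Proof.
move=> p01; rewrite integralE !integral_bernoulli_prob//.
rewrite !funeposE !funenegE -!EFinN -!EFin_max -!EFinM -!EFinD.
have maxBN (x : R) : Num.max x 0 - Num.max (- x) 0 = x.
  by rewrite !maxEle; case: (leP x 0) => ?; case: (leP (- x) 0) => ?; lra.
congr EFin; rewrite -[in RHS](maxBN (f true)) -[in RHS](maxBN (f false)).
by rewrite /unstable.onem; ring.
Qed.

Lemma two_point_has_mean {R : realType} {p : R} (a b : R) :
  0 <= p <= 1 -> has_mean (two_point p a b) (p * b + (1 - p) * a).
Proof.
move=> p01.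
have intX := integrable_bernoulli_prob (two_point_fun a b) p01.
split; first by apply: integrable_pushforward => //; exact/measurable_EFinP.
by rewrite unlock integral_distribution//= integral_bernoulli_prob_EFin.
Qed.

Lemma two_point_central_abs_moment {R : realType} (p a b m q : R) :
  0 <= p <= 1 ->
  central_abs_moment (two_point p a b) m q =
  (p * `|b - m| `^ q + (1 - p) * `|a - m| `^ q)%:E.
Proof.
move=> p01; rewrite /central_abs_moment unlock.
rewrite ge0_integral_distribution//=.
- by rewrite integral_bernoulli_prob_EFin.
- apply/measurable_EFinP.
  apply: (measurableT_comp (measurable_powR q)) => //.
  by apply: measurableT_comp => //; exact: measurable_funB.
Qed.

(** With common atoms, the two laws differ on an event by [p - q] times a difference of two
    indicator values, which lies in {-1, 0, 1}. *)
Lemma two_point_dTV {R : realType} {p q : R} (a b : R) :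
  0 <= p <= 1 -> 0 <= q <= 1 ->
  (dTV (two_point p a b) (two_point q a b) <= `|p - q|%:E)%E.
Proof.
move=> p01 q01; apply: ge_ereal_sup => _ [A mA <-].
rewrite /two_point /distribution /pushforward /= !bernoulli_probE//.
rewrite /unstable.onem !diracE -!EFinM -!EFinD lee_fin.
set u := _%:R; set v := _%:R.
have -> : p * u + (1 - p) * v - (q * u + (1 - q) * v) = (p - q) * (u - v).
  by ring.
rewrite normrM ler_piMr//.
by rewrite /u /v; case: (_ \in _); case: (_ \in _);
  rewrite ?subrr ?subr0 ?sub0r ?normrN ?normr0 ?normr1.
Qed.

Theorem theoremF1 (R : realType) (eta alpha : R)
    (heta : 0 < eta < 1) (halpha : 0 < alpha < 1) :
  exists (D1 D2 : probability (measurableTypeR R) R) (mu1 mu2 : R),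
    [/\ has_mean D1 mu1,
        has_mean D2 mu2,
        (dTV D1 D2 <= (eta / 4)%:E)%E,
        1 / 4 * eta `^ (alpha / (1 + alpha)) <= `|mu1 - mu2| &
        (central_abs_moment D1 mu1 (1 + alpha) <= 1)%E /\
        (central_abs_moment D2 mu2 (1 + alpha) <= 1)%E].
Proof.
have [eta0 eta1] := andP heta; have [alpha0 alpha1] := andP halpha.
set q := 1 + alpha; set p := eta / 4; set c := eta `^ (- q^-1).
have q1 : 1 <= q by rewrite /q; lra.
have q0 : q != 0 by rewrite gt_eqF// (lt_le_trans ltr01).
have p0 : 0 < p by rewrite /p; lra.
have p1 : p <= 1 by rewrite /p; lra.
have p01 : 0 <= p <= 1 by rewrite ltW.
have z01 : 0 <= (0 : R) <= 1 by rewrite lexx ler01.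
have c0 : 0 <= c by exact: powR_ge0.
have pc0 : 0 <= p * c := mulr_ge0 (ltW p0) c0.
have p1c0 : 0 <= (1 - p) * c by rewrite mulr_ge0// subr_ge0.
have pcq : p * c `^ q = 1 / 4.
  rewrite /c -powRrM mulNr mulVf// powR_inv1 ?ltW// /p.
  by rewrite mulrAC divff ?gt_eqF.
have pc : p * c = 1 / 4 * eta `^ (alpha / q).
  (* This splits eta^(alpha/q) as eta * eta^(-1/q) = eta * c. *)
  have -> : alpha / q = 1 - q^-1 by rewrite -[X in X - _](divff q0) /q; field.
  rewrite powRB ?(gt_eqF eta0) ?implybT// powRr1 ?ltW// /c powRN /p; ring.
(* The point mass at 0 is written with a second atom [c] of weight 0, so that both laws have the
   same atoms and [two_point_dTV] applies. *)
exists (two_point 0 0 c), (two_point p 0 c), (0 * c + (1 - 0) * 0),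
  (p * c + (1 - p) * 0).
split.
- exact: two_point_has_mean.
- exact: two_point_has_mean.
- by rewrite (le_trans (two_point_dTV _ _ z01 p01))// sub0r normrN gtr0_norm.
- rewrite mul0r !mulr0 !addr0 sub0r normrN (ger0_norm pc0).
  by rewrite pc.
rewrite !two_point_central_abs_moment// !mulr0 mul0r !addr0.
split; first by rewrite mul0r subrr normr0 powR0// mulr0 addr0 lee_fin ler01.
have -> : c - p * c = (1 - p) * c by ring.
rewrite sub0r normrN (ger0_norm pc0) (ger0_norm p1c0).
(* Contribution of the atom [c]: factor out p c^q = 1/4 and use (1 - p)^q <= 1 - p <= 1. *)
have le1 : p * ((1 - p) * c) `^ q <= 1 / 4.
  rewrite powRM ?subr_ge0// mulrCA pcq ler_piMl//.
  by rewrite (le_trans (ge1r_powR _ q1))// /p; lra.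
(* Contribution of the atom 0: drop [1 - p], then p^q <= p, as q >= 1, leaves p c^q = 1/4. The two
   contributions total at most 1/2. *)
have le2 : (1 - p) * (p * c) `^ q <= 1 / 4.
  rewrite (le_trans (ler_piMl (powR_ge0 _ _) _)) ?gerBl ?(ltW p0)//.
  by rewrite -pcq ge1r_powRZ ?p0.
by rewrite lee_fin; lra.
Qed.
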